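(* Let $\mathcal{U}\subset\mathbb{R}^n$ be compact, smooth and strictly convex with $0\in\mathrm{int}(\mathcal{U})$, let $l\ge0$, $a_0\in\mathbb{R}^n$, and let $\mathcal{X}=\{x\in\mathbb{R}^n:\|x\|_{\mathcal{U}}\le l\}$. Let the robust path uncertainty set be $\mathcal{V}=\mathcal{U}^{\circ}$, with corresponding distance-generating function $\varphi(\cdot)=g(\|\cdot\|_{\mathcal{U}})$, where $g:\mathbb{R}\to[0,\infty)$ is Legendre with $g(0)=0$ and $g'(0)=0$. Let $x_0\in\mathcal{X}$, let $\{x_k\}$ be the proximal path induced by $\varphi$, initialized at $x_0$ and associated with step sizes $\{\lambda_k>0\}$, and let $\{x_{\mathrm{CP}}(\omega):\omega\in[0,\infty)\}$ be the central path induced by $\varphi$ and initialized at the same $x_0$. Then $\{x_k:k\ge1\}\subset\{x_{\mathrm{CP}}(\omega):\omega\in[0,\infty)\}$; that is, for every $k\ge1$ there is $\omega\in[0,\infty)$ such that $x_k=x_{\mathrm{CP}}(\omega)$.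
   Context: For a closed convex set $\mathcal{C}\subseteq\mathbb{R}^n$ containing $0$: the gauge is $\|v\|_{\mathcal{C}}=\inf\{t\ge0: v\in t\mathcal{C}\}$ and the polar is $\mathcal{C}^{\circ}=\{y:\langle x,y\rangle\le1\ \forall x\in\mathcal{C}\}$ (so $\|\cdot\|_{\mathcal{V}^\circ}=\|\cdot\|_{\mathcal{U}}$ for $\mathcal{V}=\mathcal{U}^\circ$). A convex set with nonempty interior is strictly convex if for distinct boundary points the open segment between them lies in the interior; it is smooth if the supporting hyperplane at each boundary point is unique. A proper closed convex function $\psi:\mathbb{R}^n\to\mathbb{R}\cup\{+\infty\}$ is Legendre if $\mathrm{int}(\mathrm{dom}\,\psi)\ne\varnothing$, $\psi$ is differentiable and strictly convex on $\mathrm{int}(\mathrm{dom}\,\psi)$, and $\|\nabla\psi(x_n)\|_2\to\infty$ whenever $x_n\in\mathrm{int}(\mathrm{dom}\,\psi)$ converges to a boundary point of $\mathrm{dom}\,\psi$. Bregman divergence: $D_\varphi(x,y)=\varphi(x)-\varphi(y)-\langle\nabla\varphi(y),x-y\rangle$. Proximal path: $x_{k+1}=\arg\min_{x\in\mathcal{X}}\langle a_0,x\rangle+\lambda_kD_\varphi(x,x_k)$, $k=0,1,\dots$. Central path initialized at $x_0$: $x_{\mathrm{CP}}(\omega)=\arg\min_{x\in\mathcal{X}}\langle a_0,x\rangle+\omega D_\varphi(x,x_0)$ (unique for $\omega>0$; for $\omega=0$, $x=x_{\mathrm{CP}}(0)$ means that $x$ minimizes $\langle a_0,\cdot\rangle$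 over $\mathcal{X}$). *)

(* Defs.v *)
(* MathComp-Analysis development over an arbitrary [R : realType].
   Vectors of R^n are row vectors ['rV[R]_n]; their library topology is the
   usual one (it comes from the sup norm). *)
From HB Require Import structures.
From mathcomp Require Import all_boot all_order all_algebra.
From mathcomp Require Import all_classical all_reals all_analysis.

Set Implicit Arguments.
Unset Strict Implicit.
Unset Printing Implicit Defensive.

Import Order.TTheory GRing.Theory Num.Theory.
Import numFieldNormedType.Exports.

Local Open Scope classical_set_scope.
Local Open Scope ring_scope.

Section Euclidean.
Context {R : realType} {n : nat}.
Implicit Types (u v : 'rV[R]_n) (f : 'rV[R]_n -> R).

Definition dot u v : R := \sum_(i < n) u 0 i * v 0 i.

Definition norm2 u : R := Num.sqrt (dot u u).

Definition gradient f v : 'rV[R]_n := \row_(i < n) 'D_(delta_mx 0 i) f v.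

End Euclidean.

Section ConvexGeometry.
Context {R : realType} {n : nat}.
Implicit Types (C H : set 'rV[R]_n) (v : 'rV[R]_n).

Definition boundary C : set 'rV[R]_n := closure C `\` C°.

(* Valued in [\bar R]: the infimum of the empty set is +oo, so the gauge is
   finite exactly on the cone generated by C. *)
Definition gauge C v : \bar R :=
  ereal_inf [set t%:E | t in [set t : R | 0 <= t /\ [set t *: c | c in C] v]].

Definition polar C : set 'rV[R]_n :=
  [set y | forall x, C x -> dot x y <= 1].

Definition strictly_convex_set C : Prop :=
  [/\ convex_set C, C° !=set0 &
      forall x y, boundary C x -> boundary C y -> x != y ->
      forall t : R, 0 < t < 1 -> C° (t *: x + (1 - t) *: y)].

Definition supporting_hyperplane C v H : Prop :=
  exists c : 'rV[R]_n,
    [/\ c != 0, H = [set y | dot c y = dot c v] &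
        forall y, C y -> dot c y <= dot c v].

Definition smooth_set C : Prop :=
  [/\ convex_set C, C° !=set0 &
      forall v, boundary C v -> exists! H, supporting_hyperplane C v H].

End ConvexGeometry.

Section Legendre.
Context {R : realType} {n : nat}.
Implicit Types (psi : 'rV[R]_n -> \bar R).
Local Open Scope ereal_scope.

Definition edom psi : set 'rV[R]_n := [set x | psi x < +oo].

Definition proper_fun psi : Prop :=
  (forall x, psi x != -oo) /\ edom psi !=set0.

Definition convex_efun psi : Prop :=
  forall (x y : 'rV[R]_n) (t : R), (0 <= t <= 1)%R ->
    psi (t *: x + (1 - t) *: y)%R <= t%:E * psi x + (1 - t)%:E * psi y.

Definition strictly_convex_on (D : set 'rV[R]_n) psi : Prop :=
  forall (x y : 'rV[R]_n) (t : R), D x -> D y -> x != y -> (0 < t < 1)%R ->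
    psi (t *: x + (1 - t) *: y)%R < t%:E * psi x + (1 - t)%:E * psi y.

(* "Closed" (closed epigraph) is lower semicontinuity; on the interior of the
   domain of a proper function, [fine \o psi] is psi itself. *)
Definition legendre psi : Prop :=
  [/\ proper_fun psi, lower_semicontinuous psi & convex_efun psi] /\
  [/\ (edom psi)° !=set0,
      (forall x, (edom psi)° x -> differentiable (fine \o psi) x),
      strictly_convex_on (edom psi)° psi &
      forall (u : nat -> 'rV[R]_n) (x : 'rV[R]_n),
        (forall k, (edom psi)° (u k)) -> boundary (edom psi) x ->
        u @ \oo --> x ->
        (fun k => norm2 (gradient (fine \o psi) (u k))) @ \oo --> +oo%R].

End Legendre.

(* A real function of one real variable is a function on R^1. *)
Definition legendre1 {R : realType} (g : R -> R) : Prop :=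
  legendre (fun t : 'rV[R]_1 => (g (t 0 0))%:E).

Section Paths.
Context {R : realType} {n : nat}.
Implicit Types (X : set 'rV[R]_n) (phi : 'rV[R]_n -> R) (a x y : 'rV[R]_n).

Definition argmin X (f : 'rV[R]_n -> R) : set 'rV[R]_n :=
  [set x | X x /\ forall z, X z -> f x <= f z].

Definition bregman phi x y : R :=
  phi x - phi y - dot (gradient phi y) (x - y).

Definition proximal_path X a phi x0 (lambda : nat -> R)
    (x : nat -> 'rV[R]_n) : Prop :=
  x 0%N = x0 /\
  forall k, argmin X (fun z => dot a z + lambda k * bregman phi z (x k)) (x k.+1).

(* The set of values of the central path at omega: a singleton for omega > 0,
   all the minimizers of the linear objective for omega = 0. *)
Definition central_path X a phi x0 (omega : R) : set 'rV[R]_n :=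
  argmin X (fun z => dot a z + omega * bregman phi z x0).

End Paths.

Section Gauge.
Context {R : realType} {n : nat}.
Implicit Types (U : set 'rV[R]_n).

Definition gauge_ball U (l : R) : set 'rV[R]_n :=
  [set x | (gauge U x <= l%:E)%E].

(* The gauge is finite everywhere when 0 is interior to U, so that [fine]
   loses nothing there. *)
Definition gauge_dgf (g : R -> R) U : 'rV[R]_n -> R :=
  fun x => g (fine (gauge U x)).

End Gauge.

(* Main.v *)
Require Import Defs.
From HB Require Import structures.
From mathcomp Require Import all_boot all_order all_algebra.
From mathcomp Require Import all_classical all_reals all_analysis.
From mathcomp Require Import ring lra.

Set Implicit Arguments.
Unset Strict Implicit.
Unset Printing Implicit Defensive.

Import Order.TTheory GRing.Theory Num.Theory.
Import numFieldNormedType.Exports.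

Local Open Scope classical_set_scope.
Local Open Scope ring_scope.

(** Let [N] be the gauge of [U], [phi = g \o N], and [p k] the gradient of
    [phi] at the iterate [x k]. Smoothness of [U] says that each boundary point
    has exactly one normal direction. It makes [N] differentiable away from the
    origin ([sgauge_is_derive]), with [grad phi x] pointing in that direction,
    and it makes the normal cone of the feasible ball at a boundary point [x]
    the ray spanned by [grad phi x]. Hence, for [l > 0], a proximal step acts on gradients as
    a translation along [a0] followed by a rescaling ([dgf_argminP]):
    [p k - (lambda k)^-1 *: a0 = mu *: p k.+1], where [mu >= 1], and [mu = 1]
    unless [x k.+1] is on the boundary.

    By induction [p k = al *: p 0 - be *: a0] with [0 < al <= 1] and [0 <= be].
    The point of the central path with parameter [al / be] is the minimizer of
    [phi] minus the linear form of [p 0 - (be / al) *: a0 = al^-1 *: p k], and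
    [x k] satisfies the optimality conditions of that problem with
    [mu = al^-1], provided that [al = 1] or that [x k] is on the boundary.

    It remains to see that an iterate which has reached the boundary with
    [al < 1] stays there, which is the heart of [central_branch_step]. The dual
    gauge of [p k] is [g' (N (x k))]. It is at most [g' l] at [p 0], and equals
    [g' l] at [p k] when [x k] is on the boundary; by convexity, moving further
    away from [al *: p 0] along the same line cannot bring it below [g' l],
    which is what entering the interior would require. *)

(** * The Euclidean pairing *)

Section Dot.
Context {R : realType} {n : nat}.
Implicit Types (u v w : 'rV[R]_n) (t : R).

Lemma dotDl u v w : dot (u + v) w = dot u w + dot v w.
Proof. by rewrite /dot -big_split; apply: eq_bigr => i _; rewrite mxE mulrDl. Qed.

Lemma dotZl t u w : dot (t *: u) w = t * dot u w.
Proof. by rewrite /dot mulr_sumr; apply: eq_bigr => i _; rewrite mxE mulrA. Qed.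

Lemma dotC u v : dot u v = dot v u.
Proof. by apply: eq_bigr => i _; rewrite mulrC. Qed.

Lemma dotDr u v w : dot u (v + w) = dot u v + dot u w.
Proof. by rewrite dotC dotDl ![dot _ u]dotC. Qed.

Lemma dotZr t u w : dot u (t *: w) = t * dot u w.
Proof. by rewrite dotC dotZl dotC. Qed.

Lemma dotNl u w : dot (- u) w = - dot u w.
Proof. by rewrite -scaleN1r dotZl mulN1r. Qed.

Lemma dotNr u w : dot u (- w) = - dot u w.
Proof. by rewrite -scaleN1r dotZr mulN1r. Qed.

Lemma dot0l u : dot 0 u = 0.
Proof. by rewrite -(scale0r 0) dotZl mul0r. Qed.

Lemma dot0r u : dot u 0 = 0.
Proof. by rewrite dotC dot0l. Qed.

Lemma dot_gt0 u : u != 0 -> 0 < dot u u.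
Proof.
move=> u0; rewrite lt_def sumr_ge0 ?andbT => [|i _]; last first.
  by rewrite -expr2 sqr_ge0.
apply: contra u0; rewrite /dot psumr_eq0 => [/allP uu|i _]; last first.
  by rewrite -expr2 sqr_ge0.
apply/eqP/rowP => i; rewrite mxE; apply/eqP; rewrite -[_ == 0](orbb) -mulf_eq0.
exact: (uu i (mem_index_enum _)).
Qed.

Lemma dot_delta u i : dot u (delta_mx 0 i) = u 0 i.
Proof.
rewrite /dot (bigD1 i)//= mxE !eqxx mulr1 big1 ?addr0// => j ji.
by rewrite mxE (negbTE ji) andbF mulr0.
Qed.

Lemma dot_continuous w : continuous (fun u : 'rV[R]_n => dot u w).
Proof.
apply: continuous_big => [|i _ u]; first exact: add_continuous.
exact: cvgMr_tmp (@coord_continuous R 1 n 0 i u).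
Qed.

End Dot.

(** * Directional derivatives through estimates *)

(** The directional derivatives below are all obtained from estimates, which are
    easier to state without a quotient. *)
Lemma is_derive_eps (R : realType) (V : normedModType R) (f : V -> R)
    (x d : V) (L : R) :
  is_derive x d f L <->
  forall e, 0 < e -> exists2 r : R, 0 < r &
    forall h : R, `|h| < r -> `|f (h *: d + x) - f x - h * L| <= e * `|h|.
Proof.
pose q (h : R) := h^-1 *: (f (h *: d + x) - f x).
have main : (q @ 0^' --> L) <->
  forall e, 0 < e -> exists2 r : R, 0 < r &
    forall h : R, `|h| < r -> `|f (h *: d + x) - f x - h * L| <= e * `|h|.
  have qE h : h != 0 -> f (h *: d + x) - f x - h * L = h * (q h - L).
    by move=> h0; rewrite /q mulrBr -[h^-1 *: _]/(h^-1 * _) mulrA divff ?mul1r.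
  split=> [/cvgrPdist_le qL e e0|fL].
    have := qL e e0; rewrite near_withinE => /nbhs_norm0P[r /= r0 H].
    exists r => // h hr; have [->|h0] := eqVneq h 0.
      by rewrite scale0r add0r subrr mul0r subrr !normr0 mulr0.
    rewrite qE// normrM mulrC ler_wpM2r// distrC; exact: H.
  apply/cvgrPdist_le => e e0; have [r r0 H] := fL e e0.
  rewrite near_withinE; apply/nbhs_normP; exists r => //= h.
  rewrite /ball_ /= sub0r normrN => hr h0.
  have := H h hr; rewrite qE// normrM mulrC ler_pM2r ?normr_gt0//.
  by rewrite distrC.
split=> [[df dfE]|/main qL].
  by apply/main; rewrite -dfE; exact: df.
split; first exact: cvgP qL.
exact: cvg_lim qL.
Qed.

Section Derive.
Context {R : realType} {V : normedModType R}.
Implicit Types (f : V -> R) (x d : V) (L K : R).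

(** Reduces a directional derivative to a derivative in one variable, to which
    the one-variable chain rule applies. *)
Lemma is_derive_line f x d L :
  is_derive x d f L <-> is_derive (0 : R) 1 (fun h : R => f (h *: d + x)) L.
Proof.
suff lineE (h : R) :
    (h *: (1 : R) + 0 : R) *: d + x = h *: d + x /\ 0 *: d + x = x.
  split=> /is_derive_eps H; apply/is_derive_eps.
    move=> e /H[r r0 {}H]; exists r => // h /H.
    by have [-> ->] := lineE h.
  move=> e /H[r r0 {}H]; exists r => // h /H.
  by have [-> ->] := lineE h.
by rewrite addr0 scale0r add0r [_ *: 1]mulr1.
Qed.

(** An estimate on the segment from [x] to [x + d] alone suffices: this turns
    minimality over a convex set into a variational inequality. *)
Lemma is_derive_ge f x d L K : is_derive x d f L ->
  (forall t : R, 0 < t < 1 -> t * K <= f (t *: d + x) - f x) -> K <= L.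
Proof.
move=> /is_derive_eps fL fK; apply/ler_addgt0Pr => e e0.
have [r r0 H] := fL e e0.
pose t := Num.min (r / 2) (1 / 2).
have t0 : 0 < t by rewrite lt_min !divr_gt0.
have t1 : t < 1 by rewrite gt_min (_ : 1 / 2 < 1) ?orbT//; lra.
have tr : t < r by rewrite gt_min (_ : r / 2 < r)//; lra.
have := H t; rewrite gtr0_norm// => /(_ tr); rewrite ler_norml => /andP[_].
have := fK t; rewrite t0 t1 => /(_ isT) h1 h2.
by rewrite -(ler_pM2l t0) mulrDr; lra.
Qed.

Lemma is_derive_le f x d L K : is_derive x d f L ->
  (forall t : R, 0 < t < 1 -> f (t *: d + x) - f x <= t * K) -> L <= K.
Proof.
move=> fL fK; rewrite -lerN2; have fN := is_deriveN fL.
apply: (is_derive_ge fN) => t /fK; rewrite !fctE; lra.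
Qed.

End Derive.

(** * Smooth gauges *)

(** Such a [c] is a subgradient of the sublinear function [N] at [x]: a vector
    of the polar of the unit ball of [N] that attains the value [N x]. *)
Definition gauge_support {R : realType} {n : nat} (N : 'rV[R]_n -> R)
    (x c : 'rV[R]_n) : Prop :=
  dot c x = N x /\ forall z, dot c z <= N z.

(** All that the argument uses about [U], expressed through its gauge. The
    existence of supports implies subadditivity ([sgaugeD]). *)
Record smooth_gauge {R : realType} {n : nat} (N : 'rV[R]_n -> R) : Prop :=
  SmoothGauge {
    sgauge_gt0 : forall x, x != 0 -> 0 < N x;
    sgaugeZ : forall t x, 0 <= t -> N (t *: x) = t * N x;
    sgauge_bounded : exists2 M : R, 0 < M & forall x, N x <= M * `|x|;
    sgauge_support : forall x, exists c, gauge_support N x c;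
    sgauge_support_uniq : forall x c c', x != 0 ->
      gauge_support N x c -> gauge_support N x c' -> c = c' }.

Section SmoothGauge.
Context {R : realType} {n : nat} {N : 'rV[R]_n -> R} (sN : smooth_gauge N).
Implicit Types (x y z c d q : 'rV[R]_n).

Lemma sgauge0 : N 0 = 0.
Proof. by rewrite -(scale0r 0) sgaugeZ// mul0r. Qed.

Lemma sgauge_ge0 x : 0 <= N x.
Proof. by have [->|/(sgauge_gt0 sN)/ltW//] := eqVneq x 0; rewrite sgauge0. Qed.

Lemma sgaugeD x y : N (x + y) <= N x + N y.
Proof. by have [c [<- cN]] := sgauge_support sN (x + y); rewrite dotDr lerD. Qed.

(** Testing a vector of the polar against the basis vectors and their opposites
    bounds its coordinates. *)
Lemma polar_bounded : bounded_set [set c | forall z, dot c z <= N z].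
Proof.
have [M M0 NM] := sgauge_bounded sN.
pose B := \big[Num.max/0]_(i < n) (`|delta_mx 0 i : 'rV[R]_n|).
have B0 : 0 <= B by apply: bigmax_ge_id.
have leB (i : 'I_n) : `|delta_mx 0 i : 'rV[R]_n| <= B by exact: le_bigmax.
exists (M * B); split; first by rewrite num_real.
move=> K MK c /= cN; apply: le_trans (ltW MK).
rewrite [leLHS]/Num.norm/= mx_normrE; apply/bigmax_leP; split=> [|[k i] _/=].
  by rewrite mulr_ge0// ltW.
rewrite [k]ord1 ler_norml; apply/andP; split.
  rewrite lerNl -dot_delta -dotNr (le_trans (cN _))// (le_trans (NM _))//.
  by rewrite normrN ler_pM2l.
by rewrite -dot_delta (le_trans (cN _))// (le_trans (NM _))// ler_pM2l.
Qed.

Lemma polar_compact : compact [set c | forall z, dot c z <= N z].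
Proof.
apply: bounded_closed_compact; first exact: polar_bounded.
rewrite (_ : mkset _ = \bigcap_z [set c | dot c z <= N z]); last first.
  by apply/seteqP; split=> c /= cN z; [move=> _|]; exact: cN.
apply: closed_bigI => z _.
have cz := @dot_continuous R n z.
exact: ((continuous_closedP _).1 cz _ (@closed_le R (N z))).
Qed.

(** Supports at nearby points are close, because the support at [x] is unique
    and the polar is compact: the vectors [c'] of the polar that are [e]-far
    from [c] in the direction [d] satisfy [dot c' x <= N x - delta] for a
    common [delta > 0], so that none of them can be a support at a point too
    close to [x]. *)
Lemma support_continuous x c d e : x != 0 -> gauge_support N x c -> 0 < e ->
  exists2 r : R, 0 < r & forall z c', `|z| < r ->
    gauge_support N (z + x) c' -> `|dot c' d - dot c d| < e.
Proof.
move=> x0 cx e0; have [M M0 NM] := sgauge_bounded sN.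
pose K := [set c' | forall z, dot c' z <= N z] `&`
          [set c' | e <= `|dot c' d - dot c d|].
have cK : compact K.
  apply: compact_closedI; first exact: polar_compact.
  have dc : continuous (fun c' => `|dot c' d - dot c d|).
    move=> c'; have cc' := @dot_continuous R n d c'.
    exact: cvg_norm (cvgB cc' (cvg_cst (dot c d))).
  exact: ((continuous_closedP _).1 dc _ (@closed_ge R e)).
have [K0|K0] := pselect (K !=set0); last first.
  exists 1 => // z c' _ [_ c'N]; rewrite ltNge; apply/negP => ec'.
  by apply: K0; exists c'.
have [|c1] := compact_EVT_max (f := fun c' => dot c' x) K0 cK.
  by apply: continuous_subspaceT => c'; exact: dot_continuous.
rewrite inE => -[c1N c1d] c1max.
have c1x : dot c1 x < N x.
  rewrite lt_neqAle c1N andbT; apply/eqP => c1x.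
  have cc1 := sgauge_support_uniq sN x0 cx (conj c1x c1N).
  by move: c1d; rewrite /= -cc1 subrr normr0 leNgt e0.
(* Both N x - N (z + x) and dot c' z are at most M * `|z|. *)
exists ((N x - dot c1 x) / (2 * M)).
  by rewrite divr_gt0 ?subr_gt0 ?mulr_gt0.
move=> z c' zr [c'z c'N]; rewrite ltNge; apply/negP => ec'.
have := c1max c'; rewrite inE => /(_ (conj c'N ec')) c'x.
have h1 : N x <= N (z + x) + M * `|z|.
  rewrite -{1}(addKr z x) addrC (le_trans (sgaugeD _ _))// lerD2l.
  by rewrite (le_trans (NM _))// normrN.
have h2 : dot c' z <= M * `|z| by rewrite (le_trans (c'N _)).
move: zr; rewrite ltr_pdivlMr ?mulr_gt0//; move: h1; rewrite -c'z dotDr.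
lra.
Qed.

(** The increment of [N] from [x] to [x + h d] lies between [h * dot c d] and
    [h * dot c' d], where [c] and [c'] are supports at the two ends, and [c']
    tends to [c]. *)
Lemma sgauge_is_derive x c d : x != 0 -> gauge_support N x c ->
  is_derive x d N (dot c d).
Proof.
move=> x0 cx; apply/is_derive_eps => e e0.
have [r r0 H] := support_continuous d x0 cx e0.
exists (r / (`|d| + 1)) => [|h]; first by rewrite divr_gt0 ?ltr_wpDl.
rewrite ltr_pdivlMr ?ltr_wpDl// => hr.
have hdr : `|h *: d| < r.
  by rewrite normrZ (le_lt_trans _ hr)// ler_wpM2l// lerDl.
have [c' c'x] := sgauge_support sN (h *: d + x).
have dd := H _ _ hdr c'x.
have [cxE cN] := cx; have [c'E c'N] := c'x.
have lo : 0 <= N (h *: d + x) - N x - h * dot c d.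
  by have := cN (h *: d + x); rewrite dotDr dotZr -cxE; lra.
rewrite ger0_norm//.
apply: le_trans (_ : h * (dot c' d - dot c d) <= _).
  by have := c'N x; rewrite -c'E dotDr dotZr; lra.
rewrite (le_trans (ler_norm _))// normrM mulrC ler_wpM2r//; exact: ltW.
Qed.

(** Uniqueness of supports says that the normal cone of a ball of [N] at a
    boundary point is a ray. *)
Lemma support_normal x q l : x != 0 -> N x = l ->
    (forall z, N z <= l -> dot q z <= dot q x) ->
  forall c, gauge_support N x c -> exists2 t, 0 <= t & q = t *: c.
Proof.
move=> x0 xl qx c cx.
have l0 : 0 < l by rewrite -xl sgauge_gt0.
have [->|q0] := eqVneq q 0; first by exists 0; rewrite ?scale0r.
have qx0 : 0 < dot q x.
  have Nq := sgauge_gt0 sN q0.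
  have lN := divr_ge0 (ltW l0) (ltW Nq).
  have := qx ((l / N q) *: q); rewrite (sgaugeZ sN)// divfK ?gt_eqF//.
  move=> /(_ (lexx _)); apply: lt_le_trans.
  by rewrite dotZr mulr_gt0 ?divr_gt0 ?dot_gt0.
exists (dot q x / l); first by rewrite divr_ge0 ?ltW.
suff -> : c = (l / dot q x) *: q.
  by rewrite scalerA mulrA divfK ?gt_eqF// divff ?gt_eqF// scale1r.
apply: (sgauge_support_uniq sN x0 cx); split=> [|z].
  by rewrite dotZl divfK ?gt_eqF.
have [->|z0] := eqVneq z 0; first by rewrite dot0r sgauge0.
have Nz := sgauge_gt0 sN z0.
have lN := divr_ge0 (ltW l0) (ltW Nz).
have := qx ((l / N z) *: z); rewrite (sgaugeZ sN)// divfK ?gt_eqF//.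
move=> /(_ (lexx _)); rewrite dotZr mulrAC ler_pdivrMr// => qz.
by rewrite dotZl mulrAC ler_pdivrMr// [N z * _]mulrC.
Qed.

End SmoothGauge.

(** * The scalar generating function *)

(** Differentiability and strict convexity of [g], in the form in which they
    are used. *)
Record strict_tangents {R : realType} (g : R -> R) : Prop := StrictTangents {
  tangents_derivable : forall r, derivable g r 1;
  tangents_lt : forall r s, r != s -> g r + derive1 g r * (s - r) < g s }.

Section ScalarDgf.
Context {R : realType} {g : R -> R} (tg : strict_tangents g).

Lemma tangents_le r s : g r + derive1 g r * (s - r) <= g s.
Proof.
have [->|rs] := eqVneq r s; first by rewrite subrr mulr0 addr0.
exact/ltW/tangents_lt.
Qed.

Lemma derive1_lt r s : r < s -> derive1 g r < derive1 g s.
Proof.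
move=> rs; have rs' := tangents_lt tg (negbT (lt_eqF rs)).
have sr' := tangents_lt tg (negbT (gt_eqF rs)).
by rewrite -(@ltr_pM2r _ (s - r)) ?subr_gt0//; lra.
Qed.

Lemma derive1_le r s : r <= s -> derive1 g r <= derive1 g s.
Proof. by rewrite le_eqVlt => /predU1P[->//|/derive1_lt/ltW]. Qed.

End ScalarDgf.

(** Letting the chord shrink gives the tangent inequality; it is strict because
    it also holds at the midpoint, which lies strictly below the chord. *)
Lemma strictly_convex_strict_tangents (R : realType) (g : R -> R) :
    (forall r, derivable g r 1) ->
    (forall r s t, r != s -> 0 < t < 1 ->
       g (t * r + (1 - t) * s) < t * g r + (1 - t) * g s) ->
  strict_tangents g.
Proof.
move=> dg cg; have tangent r s : r != s -> derive1 g r * (s - r) <= g s - g r.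
  move=> rs; have diffg : differentiable g r by exact/derivable1_diffP.
  have dgrs : is_derive r (s - r) g (derive1 g r * (s - r)).
    apply: DeriveDef; first exact: diff_derivable.
    by rewrite deriveE// deriv1E// [RHS]mulrC.
  apply: (is_derive_le dgrs) => t /(cg s r); rewrite eq_sym => /(_ rs).
  rewrite (_ : t *: (s - r) + r = t * s + (1 - t) * r); last first.
    by rewrite [_ *: _](_ : _ = t * (s - r))//; ring.
  by lra.
split=> // r s rs; pose m := 2^-1 * r + (1 - 2^-1) * s.
have half : 0 < (2^-1 : R) < 1.
  by rewrite invr_gt0 invf_lt1 ?ltr1n ltr0n.
have rm : r != m.
  by apply: contra rs => /eqP rm; apply/eqP; move: rm; rewrite /m; lra.
have := tangent r m rm; have := cg r s _ rs half; rewrite -/m.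
have -> : m - r = (s - r) / 2 by rewrite /m; field.
by rewrite mulrA; lra.
Qed.

Lemma legendre1_strict_tangents (R : realType) (g : R -> R) :
  legendre1 g -> strict_tangents g.
Proof.
move=> [_ [_ diffg cg _]].
pose psi (t : 'rV[R]_1) := (g (t 0 0))%:E.
have dom v : (edom psi)° v.
  rewrite (_ : edom psi = setT) ?interiorT//.
  by apply/seteqP; split=> // t _; rewrite /edom /= ltry.
apply: strictly_convex_strict_tangents => [r|r s t rs t01].
  have /(@diff_derivable _ _ _ _ _ (const_mx 1)) := diffg _ (dom (const_mx r)).
  move=> /derivableP/is_derive_eps H.
  apply: (@ex_derive _ _ _ _ _ _ ('D_(const_mx 1) (fine \o psi) (const_mx r))).
  apply/is_derive_eps => e /H[d d0 {}H]; exists d => // h /H.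
  by rewrite /= !mxE.
have rs' : const_mx r != const_mx s :> 'rV[R]_1.
  by apply: contra rs => /eqP/rowP/(_ 0); rewrite !mxE => ->.
have := cg (const_mx r) (const_mx s) t (dom _) (dom _) rs' t01.
by rewrite !mxE -!EFinM -EFinD lte_fin.
Qed.

(** * The gradient of [g \o N] *)

Section GaugeDgf.
Context {R : realType} {n : nat} {N : 'rV[R]_n -> R} {g : R -> R}.
Hypotheses (sN : smooth_gauge N) (tg : strict_tangents g).
Hypothesis dg0 : derive1 g 0 = 0.
Implicit Types (x y z c d q a : 'rV[R]_n) (l w : R).

Local Notation phi := (g \o N).
Local Notation grad := (gradient phi).

Lemma dg_ge0 x : 0 <= derive1 g (N x).
Proof. by rewrite -dg0; exact: (derive1_le tg) (sgauge_ge0 sN x). Qed.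

(** Away from 0 this is the chain rule. At 0 the gauge itself need not be
    differentiable, but it grows at most linearly and [g' 0 = 0]. *)
Lemma dgf_is_derive_support x c d : gauge_support N x c ->
  is_derive x d phi (dot (derive1 g (N x) *: c) d).
Proof.
move=> cx; have dg (r : R) : is_derive r 1 g (derive1 g r).
  by rewrite derive1E; apply: derivableP; exact: (tangents_derivable tg).
have [x0|x0] := eqVneq x 0; last first.
  rewrite dotZl; apply/is_derive_line.
  have Nd := (is_derive_line N x d _).1 (sgauge_is_derive sN d x0 cx).
  apply: (@is_derive1_comp _ g (fun h : R => N (h *: d + x))).
  by rewrite scale0r add0r.
rewrite x0 (sgauge0 sN) dg0 scale0r dot0l; apply/is_derive_eps => e e0.
have [M M0 NM] := sgauge_bounded sN.
have Md0 : 0 < M * (`|d| + 1) by rewrite mulr_gt0 ?ltr_wpDl.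
have := dg 0; rewrite dg0 => /is_derive_eps /(_ _ (divr_gt0 e0 Md0))[r r0 H].
exists (r / (M * (`|d| + 1))) => [|h]; first by rewrite divr_gt0.
rewrite ltr_pdivlMr// => hr.
have Nh : N (h *: d) <= `|h| * (M * (`|d| + 1)).
  rewrite (le_trans (NM _))// normrZ mulrCA ler_wpM2l// ler_pM2l//.
  by rewrite lerDl.
have Nh0 := sgauge_ge0 sN (h *: d).
have := H (N (h *: d)); rewrite ger0_norm// => /(_ (le_lt_trans Nh hr)).
rewrite /comp !addr0 (sgauge0 sN) [_ *: (1 : R)]mulr1 !mulr0 => /le_trans; apply.
by rewrite mulrAC ler_pdivrMr// -mulrA ler_pM2l.
Qed.

Lemma dgf_gradientE x c : gauge_support N x c -> grad x = derive1 g (N x) *: c.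
Proof.
move=> cx; apply/rowP => i; rewrite mxE -dot_delta.
exact: (@derive_val _ _ _ _ _ _ _ (dgf_is_derive_support (delta_mx 0 i) cx)).
Qed.

Lemma dgf_is_derive x d : is_derive x d phi (dot (grad x) d).
Proof.
have [c cx] := sgauge_support sN x.
by rewrite (dgf_gradientE cx); exact: dgf_is_derive_support.
Qed.

(** With [dot_grad_self], this says that the dual gauge of [grad x] is
    [g' (N x)]. *)
Lemma dot_grad_le x z : dot (grad x) z <= derive1 g (N x) * N z.
Proof.
have [c cx] := sgauge_support sN x.
by rewrite (dgf_gradientE cx) dotZl ler_wpM2l ?dg_ge0//; exact: cx.2.
Qed.

Lemma dot_grad_self x : dot (grad x) x = derive1 g (N x) * N x.
Proof.
by have [c cx] := sgauge_support sN x; rewrite (dgf_gradientE cx) dotZl cx.1.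
Qed.

Lemma dgf_tangent_le x z : phi x + dot (grad x) (z - x) <= phi z.
Proof.
apply: le_trans (tangents_le tg (N x) (N z)).
by rewrite lerD2l dotDr dotNr dot_grad_self mulrBr lerD2r dot_grad_le.
Qed.

(** * Proximal steps and the central path *)

(** The optimality conditions for one step. The minimizer [x] is characterized
    by [y - grad x] lying in the normal cone of the ball at [x], and that cone
    is either 0 or the ray spanned by [grad x] itself, because [grad x] is a
    multiple of the support at [x]. The constraint thus acts on gradients as a
    mere rescaling. *)
Lemma dgf_argminP x y l : 0 < l ->
  argmin [set z | N z <= l] (fun z => phi z - dot y z) x <->
  N x <= l /\ exists2 mu, 1 <= mu & y = mu *: grad x /\ (mu = 1 \/ N x = l).
Proof.
move=> l0; split=> [[xl xmin]|[xl [mu mu1 [-> muN]]]]; last first.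
  split=> // z zl; have := dgf_tangent_le x z.
  rewrite dotDr dotNr !dotZl => phiz.
  case: muN => [->|xlE]; first by lra.
  have : 0 <= (mu - 1) * (dot (grad x) x - dot (grad x) z).
    rewrite mulr_ge0 ?subr_ge0// dot_grad_self.
    by rewrite (le_trans (dot_grad_le _ _))// ler_wpM2l ?dg_ge0// xlE.
  by rewrite mulrBl !mulrBr; lra.
split=> //; set q := y - grad x.
have qx z : N z <= l -> dot q z <= dot q x.
  move=> zl; rewrite -subr_le0.
  suff : dot y (z - x) <= dot (grad x) (z - x).
    by rewrite /q !(dotDl, dotDr, dotNl, dotNr); lra.
  apply: (is_derive_ge (dgf_is_derive x (z - x))) => t /andP[t0 t1].
  have := xmin (t *: (z - x) + x).
  rewrite [dot y (t *: _ + _)]dotDr dotZr => tmin.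
  suff /tmin : N (t *: (z - x) + x) <= l by lra.
  rewrite (_ : _ + x = t *: z + (1 - t) *: x); last first.
    by rewrite scalerBr scalerBl scale1r addrAC addrA.
  have t0' := ltW t0; have t1' : 0 <= 1 - t by rewrite subr_ge0 ltW.
  rewrite (le_trans (sgaugeD sN _ _))// !(sgaugeZ sN)//.
  rewrite (_ : l = t * l + (1 - t) * l); last by ring.
  by rewrite lerD// ler_wpM2l.
have [xlE|xneql] := eqVneq (N x) l; last first.
  have {}xl : N x < l by rewrite lt_neqAle xneql.
  exists 1 => //; split; [rewrite scale1r|by left].
  apply/eqP; rewrite -subr_eq0 -/q; apply/negPn/negP => q0.
  have Nq := sgauge_gt0 sN q0; have e0 : 0 < (l - N x) / N q.
    by rewrite divr_gt0 ?subr_gt0.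
  (* By subadditivity, this step along q ends in the ball. *)
  have := qx (x + ((l - N x) / N q) *: q); rewrite dotDr dotZr => /(_ _) qxq.
  have : 0 < (l - N x) / N q * dot q q by rewrite mulr_gt0 ?dot_gt0.
  suff /qxq : N (x + ((l - N x) / N q) *: q) <= l by lra.
  rewrite (le_trans (sgaugeD sN _ _))// (sgaugeZ sN) ?(ltW e0)//.
  by rewrite divfK ?gt_eqF// addrC subrK.
have x0 : x != 0.
  by apply: contraTneq l0 => x0; rewrite -xlE x0 (sgauge0 sN) ltxx.
have [c cx] := sgauge_support sN x.
have [t t0 qE] := support_normal sN x0 xlE qx cx.
have G0 : 0 < derive1 g l by rewrite -dg0; exact: (derive1_lt tg).
exists (1 + t / derive1 g l); first by rewrite lerDl divr_ge0 // ltW.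
split; last by right.
rewrite scalerDl scale1r (dgf_gradientE cx) scalerA xlE divfK ?gt_eqF// -qE.
by rewrite -xlE -(dgf_gradientE cx) /q addrC subrK.
Qed.

(** A mirror step: the Bregman term only shifts the linear part by the gradient
    at the previous point. *)
Lemma bregman_argminE (X : set 'rV[R]_n) a w x y : 0 < w ->
  argmin X (fun z => dot a z + w * bregman phi z y) x <->
  argmin X (fun z => phi z - dot (grad y - w^-1 *: a) z) x.
Proof.
move=> w0; suff E z : dot a z + w * bregman phi z y =
    w * (phi z - dot (grad y - w^-1 *: a) z) + w * (dot (grad y) y - phi y).
  by split=> -[Xx xmin]; split=> // z /xmin; rewrite !E lerD2r ler_pM2l.
rewrite /bregman !(dotDl, dotDr, dotNl, dotNr, dotZl).
by field; rewrite gt_eqF.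
Qed.

(** The points whose gradient is a positive multiple of
    [p0 - (be / al) *: a]. A factor [al < 1] is only allowed on the boundary of
    the ball, where [dgf_argminP] lets the central path rescale the gradient; in
    the interior it does not. *)
Definition on_central_branch (p0 a : 'rV[R]_n) (l al be : R) x : Prop :=
  [/\ 0 < al, N x <= l, grad x = al *: p0 - be *: a &
      al = 1 \/ [/\ al <= 1, N x = l & 0 < be]].

(** A step subtracts a multiple of [a] from the gradient and then divides it by
    some [mu >= 1], so the only danger is to come back to the interior with
    [al < 1]. Suppose that it happens, from [y] on the boundary. Since the
    dual gauge of the gradient decreases, pairing with [y] gives
    [0 < dot a y]. But then [grad y = al *: p0 - be *: a] pairs with [y] to
    less than [al * dot p0 y], hence to less than [g' l * l], which bounds
    [dot p0 y] because [x0] is in the ball. This contradicts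
    [dot (grad y) y = g' l * l]. *)
Lemma central_branch_step x0 a l al be y x w : 0 < l -> 0 < w -> 0 <= be ->
    N x0 <= l -> on_central_branch (grad x0) a l al be y ->
    argmin [set z | N z <= l] (fun z => dot a z + w * bregman phi z y) x ->
  exists al' be', 0 < be' /\ on_central_branch (grad x0) a l al' be' x.
Proof.
move=> l0 w0 be0 x0l [al0 yl gy aly].
move=> /(bregman_argminE _ _ _ _ w0)/(dgf_argminP _ _ l0)[xl [mu mu1 [gx muN]]].
have mu0 : 0 < mu by exact: lt_le_trans mu1.
have wi0 : 0 < w^-1 by rewrite invr_gt0.
exists (al / mu), ((be + w^-1) / mu).
have be'0 : 0 < (be + w^-1) / mu by rewrite divr_gt0 ?ltr_wpDl.
split=> //; split=> //; first exact: divr_gt0.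
  rewrite ![_ / mu]mulrC -!scalerA -scalerBr scalerDl opprD addrA -gy gx.
  by rewrite scalerA mulVf ?gt_eqF// scale1r.
case: aly => [al1|[al1 ylE bep]].
  case: muN => [->|xlE]; first by left; rewrite divr1.
  right; split=> //; by rewrite al1 ler_pdivrMr// mul1r.
right; split=> //; first by rewrite ler_pdivrMr// mul1r (le_trans al1).
case: muN => [mu1E|//]; apply/eqP; rewrite eq_le xl leNgt /=; apply/negP => xlt.
have Gl0 : 0 <= derive1 g l * l by rewrite mulr_ge0 ?(ltW l0)// -ylE dg_ge0.
have gyy : dot (grad y) y = derive1 g l * l by rewrite dot_grad_self ylE.
have ay : 0 < dot a y.
  have : dot (grad x) y < derive1 g l * l.
    rewrite (le_lt_trans (dot_grad_le _ _))// ylE ltr_pM2r//.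
    exact: (derive1_lt tg).
  have -> : grad x = grad y - w^-1 *: a by rewrite gx mu1E scale1r.
  by rewrite dotDl dotNl dotZl gyy gtrDl oppr_lt0 pmulr_rgt0.
have p0y : dot (grad x0) y <= derive1 g l * l.
  rewrite (le_trans (dot_grad_le _ _))// ylE ler_pM2r//.
  exact: (derive1_le tg).
have : al * dot (grad x0) y <= derive1 g l * l.
  by rewrite (le_trans (ler_wpM2l (ltW al0) p0y))// ler_piMl.
have := mulr_gt0 bep ay.
by move: gyy; rewrite {1}gy dotDl dotNl !dotZl; lra.
Qed.

(** The central path at [al / be] minimizes [phi] minus the linear form of
    [p0 - (be / al) *: a], which is [al^-1 *: grad x]: the conditions of
    [dgf_argminP] hold with [mu = al^-1]. *)
Lemma central_branch_argmin x0 a l al be x : 0 < l -> 0 < be ->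
    on_central_branch (grad x0) a l al be x ->
  argmin [set z | N z <= l]
    (fun z => dot a z + al / be * bregman phi z x0) x.
Proof.
move=> l0 be0 [al0 xl gx alx]; apply/bregman_argminE; first exact: divr_gt0.
apply/dgf_argminP => //; split=> //; exists al^-1.
  by rewrite invf_ge1//; case: alx => [->//|[]].
split; last by case: alx => [->|[]]; [left; rewrite invr1|right].
by rewrite gx scalerBr !scalerA mulVf ?gt_eqF// scale1r invf_div mulrC.
Qed.

Lemma proximal_path_central (a x0 : 'rV[R]_n) l (lambda : nat -> R)
    (x : nat -> 'rV[R]_n) k :
    0 < l -> N x0 <= l -> (forall k, 0 < lambda k) ->
    proximal_path [set z | N z <= l] a phi x0 lambda x ->
  exists2 w, 0 < w & central_path [set z | N z <= l] a phi x0 w (x k.+1).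
Proof.
move=> l0 x0l lam0 [x0E xS].
have branch i : exists al be, 0 <= be /\
    on_central_branch (grad x0) a l al be (x i).
  elim: i => [|i [al [be [be0 IH]]]].
    exists 1, 0; split=> //; split=> //; rewrite x0E//; last by left.
    by rewrite scale1r scale0r subr0.
  have [al' [be' [be'0 H]]] :=
    central_branch_step l0 (lam0 i) be0 x0l IH (xS i).
  by exists al', be'; split=> //; exact: ltW.
(* The branch parameter be is only known to be nonnegative at index k (it is 0
   at the start); one more step makes it positive. *)
have [al [be [be0 H]]] := branch k.
have [al' [be' [be'0 H']]] := central_branch_step l0 (lam0 k) be0 x0l H (xS k).
exists (al' / be'); first by have [al'0 _ _ _] := H'; exact: divr_gt0.
exact: central_branch_argmin.
Qed.

End GaugeDgf.

(** * The gauge of a smooth compact set *)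

Definition fgauge {R : realType} {n : nat} (U : set 'rV[R]_n) x : R :=
  fine (gauge U x).

Section SetGauge.
Context {R : realType} {n : nat} {U : set 'rV[R]_n}.
Hypotheses (U_compact : compact U) (U_int0 : U° 0).
Implicit Types (x y z c v : 'rV[R]_n).

Local Notation N := (fgauge U).

Lemma compact_norm_le : exists2 B, 0 < B & forall c, U c -> `|c| <= B.
Proof.
have [B [_ UB]] := compact_bounded U_compact.
exists (`|B| + 1); first by rewrite ltr_wpDl.
by apply: UB; rewrite (le_lt_trans (ler_norm _))// ltrDl.
Qed.

Lemma ball_subset : exists2 r : R, 0 < r & forall z, `|z| < r -> U z.
Proof. by move/nbhs_norm0P: U_int0 => [r /= r0 rU]; exists r. Qed.

Lemma gauge_ge0 x : (0 <= gauge U x)%E.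
Proof. by apply: le_ereal_inf_tmp => _ [t [t0 _] <-]; rewrite lee_fin. Qed.

Lemma gauge_le t c : 0 <= t -> U c -> (gauge U (t *: c) <= t%:E)%E.
Proof.
by move=> t0 Uc; apply: ereal_inf_lbound; exists t => //; split=> //; exists c.
Qed.

Lemma gauge_bounded : exists2 M : R, 0 < M &
  forall x, (gauge U x <= (M * `|x|)%:E)%E.
Proof.
have [r r0 rU] := ball_subset; exists (2 / r) => [|x]; first exact: divr_gt0.
have [->|x0] := eqVneq x 0.
  rewrite normr0 mulr0 -(scale0r 0); apply: gauge_le => //.
  by apply: rU; rewrite normr0.
have xp : 0 < `|x| by rewrite normr_gt0.
have Mx0 : 0 < 2 / r * `|x| by rewrite mulr_gt0 ?divr_gt0.
have -> : gauge U x = gauge U ((2 / r * `|x|) *: ((2 / r * `|x|)^-1 *: x)).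
  by rewrite scalerA divff ?gt_eqF// scale1r.
apply: gauge_le; first exact: ltW.
apply: rU; rewrite normrZ gtr0_norm ?invr_gt0// invfM mulfVK ?gt_eqF//.
by rewrite invf_div ltr_pdivrMr//; lra.
Qed.

Lemma gaugeE x : gauge U x = (N x)%:E.
Proof.
rewrite fineK// ge0_fin_numE ?gauge_ge0//.
by have [M _ /(_ x)/le_lt_trans->//] := gauge_bounded; rewrite ltry.
Qed.

Lemma fgauge_ge0 x : 0 <= N x.
Proof. by rewrite -lee_fin -gaugeE gauge_ge0. Qed.

Lemma fgauge_le t c : 0 <= t -> U c -> N (t *: c) <= t.
Proof. by move=> t0 /(gauge_le t0); rewrite gaugeE lee_fin. Qed.

Lemma fgauge_adherent x e : 0 < e ->
  exists t c, [/\ 0 <= t, N x <= t < N x + e, U c & x = t *: c].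
Proof.
move=> e0; have : (gauge U x < (N x + e)%:E)%E.
  by rewrite gaugeE lte_fin ltrDl.
move=> /ereal_inf_lt[_ [t [t0 [c Uc tc]] <-]]; rewrite lte_fin => te.
by exists t, c; split=> //; rewrite te andbT -tc fgauge_le.
Qed.

Lemma le_fgauge x b : (forall t c, 0 <= t -> U c -> x = t *: c -> b <= t) ->
  b <= N x.
Proof.
move=> H; apply/ler_addgt0Pr => e /(fgauge_adherent x)[t [c [t0 te Uc xE]]].
by move: te => /andP[_ /ltW]; apply: le_trans; exact: H xE.
Qed.

(** If [x = t *: c] with [c] in the bounded set [U], then [t] is at least a fixed
    positive multiple of [`|x|]. *)
Lemma fgauge_gt0 x : x != 0 -> 0 < N x.
Proof.
have [B B0 UB] := compact_norm_le; rewrite -normr_gt0 => x0.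
apply: (lt_le_trans (divr_gt0 x0 B0)); apply: le_fgauge => t c t0 Uc ->.
by rewrite ler_pdivrMr// normrZ ger0_norm// ler_wpM2l// UB.
Qed.

Lemma fgauge0 : N 0 = 0.
Proof.
have [r r0 rU] := ball_subset; apply/eqP; rewrite eq_le fgauge_ge0 andbT.
by rewrite -(scale0r 0); apply: fgauge_le => //; apply: rU; rewrite normr0.
Qed.

Lemma fgaugeZ t x : 0 <= t -> N (t *: x) = t * N x.
Proof.
rewrite le_eqVlt => /predU1P[<-|]; first by rewrite scale0r fgauge0 mul0r.
suff H s y : 0 < s -> N (s *: y) <= s * N y.
  move=> t0; apply/eqP; rewrite eq_le H//= -ler_pdivlMl//.
  rewrite -{1}[x](scalerK (lt0r_neq0 t0)) H// invr_gt0//.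
move=> s0; rewrite -ler_pdivrMl//; apply: le_fgauge => r c r0 Uc ->.
by rewrite ler_pdivrMl// scalerA fgauge_le// mulr_ge0// ltW.
Qed.

(** A point at gauge 1 is a limit of points of [U], obtained by dividing it by
    numbers [t] slightly above 1; if it were interior to [U], a slight dilation
    of it would stay in [U] and its gauge would be less than 1. *)
Lemma fgauge1_boundary v : N v = 1 -> boundary U v.
Proof.
move=> Nv; split.
  have [B B0 UB] := compact_norm_le.
  move=> A /nbhs_normP[r /= r0 rA].
  have [t [c [t0 /andP[]]]] := fgauge_adherent v (divr_gt0 r0 B0).
  rewrite Nv => t1 tr Uc vE; exists c; split=> //; apply: rA => /=.
  rewrite vE -[X in _ - X]scale1r -scalerBl normrZ ger0_norm ?subr_ge0//.
  rewrite (le_lt_trans (ler_wpM2l _ (UB _ Uc))) ?subr_ge0//.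
  by rewrite -ltr_pdivlMr// ltrBlDl.
move=> /nbhs_normP[r /= r0 rU].
pose e := r / (`|v| + 1); have e0 : 0 < e by rewrite divr_gt0 ?ltr_wpDl.
have Uv : U ((1 + e) *: v).
  apply: rU => /=; rewrite scalerDl scale1r opprD addrA subrr sub0r normrN.
  rewrite normrZ gtr0_norm// /e mulrAC ltr_pdivrMr ?ltr_wpDl// ltr_pM2l//.
  by rewrite ltrDl.
have e1 : 0 < 1 + e by rewrite addr_gt0.
have : N ((1 + e)^-1 *: ((1 + e) *: v)) <= (1 + e)^-1.
  by rewrite fgauge_le// ltW// invr_gt0.
rewrite scalerK ?gt_eqF// Nv leNgt invf_lt1// ltrDl e0 //.
Qed.

Lemma dot_le_fgauge c : (forall y, U y -> dot c y <= 1) ->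
  forall z, dot c z <= N z.
Proof.
move=> cU z; apply: le_fgauge => t y t0 Uy ->.
by rewrite dotZr -[leRHS]mulr1 ler_wpM2l// cU.
Qed.

Lemma fgauge_support_scale t x c : 0 < t ->
  gauge_support N (t *: x) c <-> gauge_support N x c.
Proof.
move=> t0; rewrite /gauge_support fgaugeZ ?ltW// dotZr.
split=> -[E cN]; split=> //; last by rewrite E.
by apply/eqP; rewrite -(inj_eq (mulfI (lt0r_neq0 t0))) E.
Qed.

(** A small multiple of [c] belongs to [U], because 0 is interior to it. *)
Lemma supporting_hyperplane_gt0 v c : c != 0 ->
  (forall y, U y -> dot c y <= dot c v) -> 0 < dot c v.
Proof.
have [r r0 rU] := ball_subset => c0 cU.
have cp : 0 < `|c| by rewrite normr_gt0.
have h0 : 0 < r / 2 / `|c| by rewrite !divr_gt0.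
have /cU : U ((r / 2 / `|c|) *: c).
  apply: rU; rewrite normrZ gtr0_norm// divfK ?gt_eqF//; lra.
by apply: lt_le_trans; rewrite dotZr mulr_gt0 ?dot_gt0.
Qed.

Hypothesis U_smooth : smooth_set U.

(** Smoothness provides a supporting hyperplane at the boundary point on the ray
    of [x]; normalizing its functional to take the value 1 at that point gives a
    support. *)
Lemma fgauge_support_exists x : exists c, gauge_support N x c.
Proof.
have [->|x0] := eqVneq x 0.
  exists 0; split=> [|z]; rewrite dot0l ?fgauge0//; exact: fgauge_ge0.
have Nx := fgauge_gt0 x0; have Nxi : 0 < (N x)^-1 by rewrite invr_gt0.
pose v := (N x)^-1 *: x.
have Nv : N v = 1 by rewrite fgaugeZ ?ltW// mulVf ?gt_eqF.
have [_ _ /(_ v (fgauge1_boundary Nv))[H [[c [c0 _ cU]] _]]] := U_smooth.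
have cv := supporting_hyperplane_gt0 c0 cU.
exists ((dot c v)^-1 *: c); apply/(fgauge_support_scale _ _ Nxi); split.
  by rewrite dotZl mulVf ?gt_eqF.
apply: dot_le_fgauge => y /cU; rewrite dotZl => cy.
by rewrite ler_pdivrMl// mulr1.
Qed.

(** Any vector is moved into the level set of [c] through [v] by adding a
    multiple of [v], on which both functionals take the value 1. *)
Lemma dot_level_inj v c c' : dot c v = 1 -> dot c' v = 1 ->
  [set y | dot c y = dot c v] = [set y | dot c' y = dot c' v] -> c = c'.
Proof.
move=> cv c'v /seteqP[cc' _]; apply/rowP => i.
have := cc' (delta_mx 0 i + (1 - c 0 i) *: v).
rewrite /= !dotDr !dotZr !dot_delta cv c'v.
by move=> /(_ ltac:(ring)); lra.
Qed.

Lemma fgauge_support_uniq x c c' : x != 0 ->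
  gauge_support N x c -> gauge_support N x c' -> c = c'.
Proof.
move=> x0; have Nx := fgauge_gt0 x0.
have Nxi : 0 < (N x)^-1 by rewrite invr_gt0.
move=> /(fgauge_support_scale _ _ Nxi) cx /(fgauge_support_scale _ _ Nxi) c'x.
move: cx c'x; set v := _ *: x => cv c'v.
have Nv : N v = 1 by rewrite fgaugeZ ?ltW// mulVf ?gt_eqF.
have hyper d : gauge_support N v d ->
    supporting_hyperplane U v [set y | dot d y = dot d v].
  move=> [dv dN]; exists d; split=> // [|y Uy].
    apply: contra_eq_neq dv => ->; rewrite dot0l Nv eq_sym; exact: oner_neq0.
  by rewrite dv Nv (le_trans (dN y))// -[y]scale1r fgauge_le.
have [_ _ /(_ v (fgauge1_boundary Nv))[H [_ HU]]] := U_smooth.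
apply: (@dot_level_inj v); [by rewrite cv.1|by rewrite c'v.1|].
by rewrite -(HU _ (hyper _ cv)) -(HU _ (hyper _ c'v)).
Qed.

Lemma smooth_set_gauge : smooth_gauge N.
Proof.
split; first exact: fgauge_gt0.
- by move=> t x; exact: fgaugeZ.
- have [M M0 UM] := gauge_bounded; exists M => // x.
  by rewrite -lee_fin -gaugeE.
- exact: fgauge_support_exists.
- exact: fgauge_support_uniq.
Qed.

Lemma gauge_ballE l : gauge_ball U l = [set z | N z <= l].
Proof. by apply/seteqP; split=> z; rewrite /gauge_ball/= gaugeE lee_fin. Qed.

End SetGauge.

Theorem proposition2 (R : realType) (n : nat)
  (U : set 'rV[R]_n)
  (U_compact : compact U) (U_smooth : smooth_set U)
  (U_strict : strictly_convex_set U) (U_int0 : U° 0)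
  (l : R) (l_ge0 : 0 <= l) (a0 : 'rV[R]_n)
  (X : set 'rV[R]_n) (X_def : X = gauge_ball U l)
  (V : set 'rV[R]_n) (V_def : V = polar U)
  (g : R -> R) (g_ge0 : forall t, 0 <= g t) (g_legendre : legendre1 g)
  (g0 : g 0 = 0) (dg0 : derive1 g 0 = 0)
  (phi : 'rV[R]_n -> R) (phi_def : phi = gauge_dgf g U)
  (x0 : 'rV[R]_n) (x0_X : X x0)
  (lambda : nat -> R) (lambda_gt0 : forall k, 0 < lambda k)
  (x : nat -> 'rV[R]_n) (x_prox : proximal_path X a0 phi x0 lambda x) :
  forall k, (1 <= k)%N ->
    exists2 omega : R, 0 <= omega & central_path X a0 phi x0 omega (x k).
Proof.
case=> [//|k] _.
have sN := smooth_set_gauge U_compact U_int0 U_smooth.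
have tg := legendre1_strict_tangents g_legendre.
have XE : X = [set z | fgauge U z <= l] by rewrite X_def (gauge_ballE U_int0).
rewrite XE in x0_X x_prox *.
have [l0|l0] := eqVneq l 0; last first.
  have lp : 0 < l by rewrite lt_neqAle eq_sym l0.
  rewrite phi_def in x_prox *.
  have [w w0 xw] :=
    proximal_path_central sN tg dg0 k lp x0_X lambda_gt0 x_prox.
  by exists w => //; exact: ltW.
(* For l = 0 the normal cone at the origin is the whole space, and gradients no
   longer follow the steps; but the origin is the only feasible point. *)
have single z : fgauge U z <= l -> z = 0.
  by apply: contraTeq => z0; rewrite l0 -ltNge (sgauge_gt0 sN).
have [_ /(_ k)[xk _]] := x_prox.
exists 0 => //; split=> // z zl.
by rewrite (single z zl) (single _ xk).
Qed.
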